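(* Let $T$ and $T'$ be nontrivial trees such that $\operatorname{diam}(T\square T')$ is even. Then \[ \operatorname{aw}(T\square T',3)=\begin{cases} 3 & \text{if at least one of } T, T' \text{ is weakly non-}3\text{-peripheral or isomorphic to } P_2,\\ 4 & \text{if } T \text{ and } T' \text{ are both strongly non-}3\text{-peripheral and neither is isomorphic to } P_2. \end{cases} \]
   Context: All graphs are finite, simple and undirected; $\mathrm{d}$ (or $\mathrm{d}_G$) denotes graph distance, $\operatorname{diam}$ the diameter, $P_n$ the path on $n$ vertices. A tree is nontrivial if it has at least two vertices. The Cartesian product $G\square H$ has vertex set $V(G)\times V(H)$, with $(x,y)$ adjacent to $(x',y')$ iff either $x=x'$ and $yy'\in E(H)$, or $y=y'$ and $xx'\in E(G)$. Colorings: an exact $r$-coloring of $G$ is a surjective function $c:V(G)\to\{1,\dots,r\}$. A $k$-term arithmetic progression ($k$-AP) in a connected graph $G$ with common difference $d$ is a list of vertices $(v_1,\dots,v_k)$ with $\mathrm{d}(v_i,v_{i+1})=d$ for $1\le i<k$. It is rainbow if its vertices all have distinct colors. The anti-van der Waerden number $\operatorname{aw}(G,k)$ is the least $r$ such that every exact $r$-coloring of $G$ contains a rainbow $k$-AP. Peripherality: a vertex $v$ of a connected graph $G$ is peripheral if its eccentricity (the maximum distance from $v$ to a vertex of $G$) equals $\operatorname{diam}(G)$. $G$ is $3$-peripheral if it contains three distinct vertices that are pairwise at distance $\operatorname{diam}(G)$; otherwise it is non-$3$-peripheral. For a tree $T$ and a peripheral vertex $v$ of $T$, $T_{v^-}$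 is the tree obtained from $T$ by deleting all vertices at distance $\operatorname{diam}(T)$ from $v$. For any vertex $u$ of $T$, $T_{u^+}$ is the tree obtained from $T$ by adding one new leaf adjacent to $u$. Let $T$ be a nontrivial non-$3$-peripheral tree. If $\operatorname{diam}(T)$ is odd, $T$ is strongly non-$3$-peripheral if there exists a peripheral vertex $v$ such that $T_{v^-}$ is non-$3$-peripheral; otherwise (i.e. $T_{v^-}$ is $3$-peripheral for every peripheral vertex $v$) $T$ is weakly non-$3$-peripheral. If $\operatorname{diam}(T)$ is even, $T$ is strongly non-$3$-peripheral if $T_{v^+}$ is non-$3$-peripheral for every $v\in V(T)$; otherwise (i.e. $T_{v^+}$ is $3$-peripheral for some $v\in V(T)$) $T$ is weakly non-$3$-peripheral. *)

(* Defs.v *)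
From mathcomp Require Import all_boot.

Set Implicit Arguments.
Unset Strict Implicit.
Unset Printing Implicit Defensive.

Record sgraph := SGraph {
  vertex :> finType;
  adj : rel vertex;
  adj_sym : symmetric adj;
  adj_irr : irreflexive adj
}.

Definition giso (G H : sgraph) : Prop :=
  exists f : G -> H, bijective f /\ forall x y, adj (f x) (f y) = adj x y.

Section Metric.
Variable G : sgraph.
Implicit Types x y z : G.

Definition walk_of_length x y (n : nat) : bool :=
  [exists p : n.-tuple G, path (@adj G) x p && (last x p == y)].

(* Shortest walks have fewer than #|G| edges, so lengths in iota 0 #|G| suffice;
   the value is #|G| when x and y lie in different components. *)
Definition dist x y : nat := find (walk_of_length x y) (iota 0 #|G|).

Definition ecc x : nat := \max_(y : G) dist x y.

Definition diam : nat := \max_(x : G) ecc x.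

Definition peripheral x : bool := ecc x == diam.

Definition three_peripheral : bool :=
  [exists x : G, exists y : G, exists z : G,
    [&& uniq [:: x; y; z], dist x y == diam, dist y z == diam
      & dist x z == diam]].

Definition gconnected : Prop := 0 < #|G| /\ forall x y, connect (@adj G) x y.

(* The bound on size p excludes the degenerate 2-cycles [:: x; y] that every
   edge yields for ucycle. *)
Definition acyclic : Prop :=
  forall p : seq G, 2 < size p -> ~ ucycle (@adj G) p.

Definition is_tree : Prop := gconnected /\ acyclic.

End Metric.

Section PathGraph.
Variable n : nat.

Definition path_adj : rel 'I_n := fun i j => (i.+1 == j) || (j.+1 == i).

Lemma path_adj_sym : symmetric path_adj.
Proof. by move=> i j; rewrite /path_adj orbC. Qed.

Lemma path_adj_irr : irreflexive path_adj.
Proof. by move=> i; rewrite /path_adj orbb gtn_eqF. Qed.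

Definition path_graph : sgraph := SGraph path_adj_sym path_adj_irr.

End PathGraph.

Section Cartesian.
Variables G H : sgraph.

Definition cart_adj : rel (G * H) := fun u v =>
  (u.1 == v.1) && adj u.2 v.2 || (u.2 == v.2) && adj u.1 v.1.

Lemma cart_adj_sym : symmetric cart_adj.
Proof.
move=> u v; rewrite /cart_adj (eq_sym u.1) (eq_sym u.2).
by rewrite (adj_sym u.1) (adj_sym u.2).
Qed.

Lemma cart_adj_irr : irreflexive cart_adj.
Proof. by move=> u; rewrite /cart_adj !adj_irr !andbF. Qed.

Definition cart_prod : sgraph := SGraph cart_adj_sym cart_adj_irr.

End Cartesian.

Notation "G □ H" := (cart_prod G H) (at level 40, left associativity).

Section Coloring.
Variable G : sgraph.

Definition exact_coloring (r : nat) (c : {ffun G -> 'I_r}) : bool :=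
  [forall i : 'I_r, exists x : G, c x == i].

Definition is_AP (k d : nat) (v : k.-tuple G) : bool :=
  sorted [rel x y | dist x y == d] v.

(* The bound on d loses nothing, since dist never exceeds #|G|. *)
Definition has_rainbow_AP (k r : nat) (c : {ffun G -> 'I_r}) : bool :=
  [exists v : k.-tuple G, exists d : 'I_(#|G|).+1,
    is_AP d v && uniq (map c v)].

(* r = 0 has to be excluded: a nonempty graph has no exact 0-coloring, so the
   second condition would hold vacuously there. *)
Definition forces_rainbow (k r : nat) : bool :=
  (0 < r) && [forall c : {ffun G -> 'I_r},
                exact_coloring c ==> has_rainbow_AP k c].

Lemma forces_rainbow_exists (k : nat) : exists r, forces_rainbow k r.
Proof.
exists #|G|.+1; apply/andP; split=> //; apply/forallP=> c; apply/implyP=> sc.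
have: #|'I_(#|G|).+1| <= #|G|.
  apply: leq_trans (leq_image_card c predT); apply/subset_leq_card/subsetP=> i _.
  by have /existsP[x /eqP <-] := forallP sc i; apply: image_f.
by rewrite card_ord ltnn.
Qed.

Definition aw (k : nat) : nat := ex_minn (forces_rainbow_exists k).

End Coloring.

Section Peripherality.
Variable T : sgraph.

Definition del_far_pred (v : T) : pred T := fun u => dist v u != diam T.

Definition del_far_adj (v : T) : rel {u : T | del_far_pred v u} :=
  fun x y => adj (val x) (val y).

Lemma del_far_adj_sym v : symmetric (@del_far_adj v).
Proof. by move=> x y; apply: adj_sym. Qed.

Lemma del_far_adj_irr v : irreflexive (@del_far_adj v).
Proof. by move=> x; apply: adj_irr. Qed.

(* T_{v^-} *)
Definition del_far (v : T) : sgraph :=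
  SGraph (@del_far_adj_sym v) (@del_far_adj_irr v).

Definition add_leaf_adj (u : T) : rel (option T) := fun x y =>
  match x, y with
  | Some a, Some b => adj a b
  | Some a, None => a == u
  | None, Some b => b == u
  | None, None => false
  end.

Lemma add_leaf_adj_sym u : symmetric (add_leaf_adj u).
Proof. by move=> [x|] [y|] //=; apply: adj_sym. Qed.

Lemma add_leaf_adj_irr u : irreflexive (add_leaf_adj u).
Proof. by move=> [x|] //=; apply: adj_irr. Qed.

(* T_{u^+}, with None as the new leaf *)
Definition add_leaf (u : T) : sgraph :=
  SGraph (add_leaf_adj_sym u) (add_leaf_adj_irr u).

Definition strongly_non_three_peripheral : bool :=
  ~~ three_peripheral T &&
  (if odd (diam T)
   then [exists v : T, peripheral v && ~~ three_peripheral (del_far v)]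
   else [forall v : T, ~~ three_peripheral (add_leaf v)]).

Definition weakly_non_three_peripheral : bool :=
  ~~ three_peripheral T &&
  (if odd (diam T)
   then [forall v : T, peripheral v ==> three_peripheral (del_far v)]
   else [exists v : T, three_peripheral (add_leaf v)]).

End Peripherality.

(* Main.v *)
(* Colour G = T □ T' without rainbow 3-APs, using at least three colours.
   Products of trees are median graphs, so some interval I(r, b) with c r <> c b
   contains a third colour; take one with k = d(r, b) minimal.  Minimality makes
   the interior of I(r, b) monochromatic, k is odd (else a midpoint gives a
   rainbow AP), r and b differ in both coordinates, and the whole sphere S(r, k)
   is coloured like b and S(b, k) like r.  In particular both coordinate
   eccentricities of r are below k.
   - A vertex y of a fourth colour has d(r, y) > k; stepping to distance k
     towards y swaps the roles of r and b, so d(r, y) > 2k, too far.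
   - Moving along these spheres one may assume that r.1, b.1 realise diam T.  If
     T is weakly non-3-peripheral or P_2, some z has d(r.1, z) = diam T - 1 and
     d(z, b.1) >= diam T - 1; the spheres around r and around a vertex over z
     force an interior vertex of some minimal interval to have the colour of r;
     the parity of diam G excludes the only way out.
   - If both trees are strongly non-3-peripheral, choose diametral pairs (u, v),
     (u', v').  Colour 0 the vertices at maximal distance from (u, u'), colour 1
     those at distance diam G - 1 from (v, v'), and colour 2 the rest. *)
Require Import Defs.
From mathcomp Require Import all_boot zify.

Set Implicit Arguments.
Unset Strict Implicit.
Unset Printing Implicit Defensive.

(** * Median metrics *)

(** Holds for tree distances and passes to products, so that intervals in [T], [T'] and [T □ T'] are
    handled alike. *)
Record median_metric (T : Type) (d : T -> T -> nat) : Prop := MedianMetric {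
  mm_refl : forall x, d x x = 0;
  mm_eq0 : forall x y, d x y = 0 -> x = y;
  mm_sym : forall x y, d x y = d y x;
  mm_tri : forall x y z, d x z <= d x y + d y z;
  mm_geo : forall x y j, j <= d x y ->
    exists2 z, d x z = j & d x z + d z y = d x y;
  mm_med : forall x y z, exists m,
    [/\ d x m + d m y = d x y, d x m + d m z = d x z & d y m + d m z = d y z]
}.

(** The condition characterising tree metrics. Products of nontrivial trees violate it, so it is
    assumed of the factors only. *)
Definition four_point (T : Type) (d : T -> T -> nat) : Prop :=
  forall x y u v, d x y + d u v <= maxn (d x u + d y v) (d x v + d y u).

Section MedianMetric.
Variables (T : eqType) (d : T -> T -> nat).
Hypothesis dP : median_metric d.

(** The perimeter of a triangle is twice the sum of the distances to a median. *)
Lemma mm_parity x y z : ~~ odd (d x y + d y z + d x z).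
Proof.
have [m [xy xz yz]] := mm_med dP x y z.
have := mm_sym dP y m; lia.
Qed.

Lemma mm_gt0 x y : x != y -> 0 < d x y.
Proof. by rewrite lt0n; apply: contra_neq => /(mm_eq0 dP). Qed.

Lemma mm_neq x y : 0 < d x y -> x != y.
Proof. by apply: contraTneq => ->; rewrite (mm_refl dP). Qed.

(** Since neither [u] nor [v] is farther from [x] than [y] is, the four-point condition for
    [x, y, u, v] puts one of them at distance [D] from [y]. *)
Lemma farthest_peripheral D x y u v :
  four_point d -> (forall x y, d x y <= D) -> d u v = D ->
  (forall z, d x z <= d x y) -> exists z, d y z = D.
Proof.
move=> fp leD uv far; have := fp x y u v.
have := far u; have := far v; have := leD y u; have := leD y v.
by case: (ltnP (d y u) D) => yu; [exists v | exists u]; lia.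
Qed.

End MedianMetric.

Definition prod_dist (T T' : Type) (d : T -> T -> nat) (d' : T' -> T' -> nat)
  (u v : T * T') := d u.1 v.1 + d' u.2 v.2.

Lemma prod_median_metric (T T' : Type) (d : T -> T -> nat)
    (d' : T' -> T' -> nat) :
  median_metric d -> median_metric d' -> median_metric (prod_dist d d').
Proof.
rewrite /prod_dist => dP dP'; split.
- by move=> x; rewrite (mm_refl dP) (mm_refl dP').
- move=> [x x'] [y y'] /= /eqP; rewrite addn_eq0 => /andP[/eqP e /eqP e'].
  by rewrite (mm_eq0 dP e) (mm_eq0 dP' e').
- by move=> x y; rewrite (mm_sym dP) (mm_sym dP').
- move=> x y z; have := mm_tri dP x.1 y.1 z.1; have := mm_tri dP' x.2 y.2 z.2.
  lia.
- move=> [x x'] [y y'] j /= lej.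
  have [] := mm_geo dP (x := x) (y := y) (j := minn j (d x y)); first by lia.
  move=> z xz zy.
  have [] := mm_geo dP' (x := x') (y := y') (j := j - d x z); first by lia.
  by move=> z' xz' zy'; exists (z, z') => /=; lia.
- move=> [x x'] [y y'] [z z'] /=.
  have [m [? ? ?]] := mm_med dP x y z; have [m' [? ? ?]] := mm_med dP' x' y' z'.
  by exists (m, m') => /=; split; lia.
Qed.

(* Satisfied by P_2 and by the weakly non-3-peripheral trees of diameter D; the
   parity of d x y + d y z + d x z decides whether d z y is D.-1 or D. *)
Definition near_triples (T : Type) (d : T -> T -> nat) (D : nat) : Prop :=
  forall x y, d x y = D -> exists z, d x z = D.-1 /\ D.-1 <= d z y.

Definition rainbow_free (T : Type) (d : T -> T -> nat) (C : eqType)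
  (c : T -> C) : Prop :=
  forall x y z, d x y = d y z -> c x != c y -> c y != c z -> c x = c z.

(** * Rainbow-free colorings of median metrics *)

Section Tricolored.
Variables (X : finType) (d : X -> X -> nat) (C : eqType) (c : X -> C).
Hypotheses (dP : median_metric d) (cP : rainbow_free d c).

Definition tricolored r b : bool :=
  (c r != c b) &&
  [exists z, [&& d r z + d z b == d r b, c z != c r & c z != c b]].

Lemma tricoloredP r b w : c r != c b -> d r w + d w b = d r b ->
  c w != c r -> c w != c b -> tricolored r b.
Proof.
move=> rb wI wr wb; rewrite /tricolored rb; apply/existsP; exists w.
by rewrite wI eqxx wr wb.
Qed.

Lemma tricolored_sym r b : tricolored r b -> tricolored b r.
Proof.
case/andP=> rb /existsP[w /and3P[/eqP wI wr wb]].
apply: (@tricoloredP _ _ w) => //; first by rewrite eq_sym.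
by rewrite (mm_sym dP b r) -wI addnC (mm_sym dP b) (mm_sym dP w).
Qed.

(** The median lies in all three intervals, and its color differs from those of at least two of the
    vertices. *)
Lemma tricolored_exists x y z : uniq [:: c x; c y; c z] ->
  exists r b, tricolored r b.
Proof.
rewrite /= !inE negb_or andbT => /andP[/andP[xy xz] yz].
have [m [mxy mxz myz]] := mm_med dP x y z.
have [mx|mx] := eqVneq (c m) (c x).
  by exists y, z; apply: (@tricoloredP _ _ m) => //; rewrite mx.
have [my|my] := eqVneq (c m) (c y).
  by exists x, z; apply: (@tricoloredP _ _ m) => //; rewrite my // eq_sym.
by exists x, y; apply: (@tricoloredP _ _ m).
Qed.

Lemma min_tricolored r b : tricolored r b -> exists k,
  (exists r' b', tricolored r' b' /\ d r' b' = k) /\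
  (forall r' b', tricolored r' b' -> k <= d r' b').
Proof.
move=> rb.
have ex : exists n, [exists r', exists b', tricolored r' b' && (d r' b' == n)].
  exists (d r b); apply/existsP; exists r; apply/existsP; exists b.
  by rewrite rb eqxx.
case: (ex_minnP ex) => k /existsP[r' /existsP[b' /andP[rb' /eqP kE]]] kmin.
exists k; split; first by exists r', b'.
move=> x y xy; apply: kmin.
by apply/existsP; exists x; apply/existsP; exists y; rewrite xy eqxx.
Qed.

Variable k : nat.
Hypothesis kmin : forall r b, tricolored r b -> k <= d r b.

Definition good r b := tricolored r b /\ d r b = k.

Lemma good_sym r b : good r b -> good b r.
Proof.
by case=> rb rbk; split; [apply: tricolored_sym | rewrite (mm_sym dP)].
Qed.

Lemma good_neq r b : good r b -> c r != c b.
Proof. by case=> /andP[]. Qed.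

(** Otherwise the interval from [z] to [b] (if [z] is colored like [r]) or the one from [r] to [w]
    would be tricolored and shorter than [k]. *)
Lemma good_spread r b w z : good r b -> d r w + d w b = k ->
  c w != c r -> c w != c b -> d r z + d z w = d r w -> z != r -> c z = c w.
Proof.
move=> [/andP[rb _] rbk] wI wr wb zI nzr.
have wnb : w != b by apply: contraNneq wb => ->.
have := mm_gt0 dP nzr; have := mm_gt0 dP wnb.
rewrite (mm_sym dP z r) => wb0 rz0.
have [//|zw] := eqVneq (c z) (c w).
have [zr|zr] := eqVneq (c z) (c r).
  have zb : d z w + d w b = d z b.
    have := mm_tri dP r z b; have := mm_tri dP z w b; lia.
  have /kmin : tricolored z b by apply: (tricoloredP (w := w)); rewrite ?zr.
  by have := mm_tri dP r z w; lia.
have /kmin : tricolored r w by apply: (tricoloredP (w := z)); rewrite // eq_sym.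
lia.
Qed.

Lemma good_spread_r r b w z : good r b -> d r w + d w b = k ->
  c w != c r -> c w != c b -> d w z + d z b = d w b -> z != b -> c z = c w.
Proof.
move=> /good_sym rbG wI wr wb zI nzb.
have := mm_sym dP r w; have := mm_sym dP w b; have := mm_sym dP w z.
have := mm_sym dP z b => zb wz wbS rw.
by apply: (good_spread rbG _ wb wr _ nzb); lia.
Qed.

(** If the median of [r, z, w] is not [r], the color of [w] spreads to that median and from there to
    [z]; the same works at [b]. If the medians are [r] and [b], going from [z] to [w] around either
    end is geodesic, so [d z w = k]. *)
Lemma good_interior_non_antipodal r b w z : good r b ->
  d r w + d w b = k -> c w != c r -> c w != c b ->
  d r z + d z b = k -> z != r -> z != b -> d z w != k -> c z = c w.
Proof.
move=> rbG wI wr wb zI nzr nzb zw; have rbk := rbG.2.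
have [m [rzm rwm zwm]] := mm_med dP r z w.
have [m' [bzm bwm zwm']] := mm_med dP b z w.
have [mr|nmr] := eqVneq m r; last first.
  rewrite -(good_spread rbG wI wr wb rwm nmr).
  have cm := good_spread rbG wI wr wb rwm nmr.
  have mzb : d m z + d z b = d m b.
    have := mm_tri dP r m b; have := mm_tri dP m z b; lia.
  have mI : d r m + d m b = k by lia.
  apply: (good_spread_r rbG mI) => //; by rewrite cm.
have [mb|nmb] := eqVneq m' b; last first.
  have bw : d w m' + d m' b = d w b.
    by rewrite (mm_sym dP m') (mm_sym dP w) (mm_sym dP w b); lia.
  have cm := good_spread_r rbG wI wr wb bw nmb; rewrite -cm.
  have rzm' : d r z + d z m' = d r m'.
    have := mm_tri dP r m' b; have := mm_tri dP r z m'.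
    have := mm_sym dP m' b; have := mm_sym dP z m'; have := mm_sym dP b z; lia.
  have mI : d r m' + d m' b = k.
    have := mm_sym dP m' b; have := mm_sym dP z m'; have := mm_sym dP b z; lia.
  apply: (good_spread rbG mI) => //; by rewrite cm.
move: zwm zwm' zw; rewrite mr mb.
have := mm_sym dP z r; have := mm_sym dP z b; have := mm_sym dP b w; lia.
Qed.

Lemma good_interior r b w z : good r b ->
  d r w + d w b = k -> c w != c r -> c w != c b ->
  d r z + d z b = k -> z != r -> z != b -> c z = c w.
Proof.
move=> rbG wI wr wb zI nzr nzb.
have [zw|] := eqVneq (d z w) k; last exact: (good_interior_non_antipodal rbG).
have nwr : w != r by apply: contraNneq wr => ->.
have nwb : w != b by apply: contraNneq wb => ->.
have rw0 := mm_gt0 dP nwr; have wb0 := mm_gt0 dP nwb.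
have rwS := mm_sym dP r w.
(* In the antipodal case [w] is replaced by a neighbor of its color; by parity this one is not
   antipodal to [z]. Such a neighbor exists unless [r, w, b] is itself a rainbow progression of
   difference 1. *)
have step v : d w v = 1 -> d r v + d v b = k -> c v = c w -> c z = c w.
  move=> wv vI cv; rewrite -cv.
  apply: (good_interior_non_antipodal rbG) => //; rewrite ?cv //.
  by apply/eqP => zv; have := mm_parity dP z w v; lia.
have [wb2|wb2] := leqP 2 (d w b).
  have [|v wv vb] := mm_geo dP (x := w) (y := b) (j := 1); first by lia.
  apply: (step v) => //.
    have := mm_tri dP r w v; have := mm_tri dP r v b; have := rbG.2; lia.
  apply: (good_spread_r rbG wI) => //.
  by apply: (mm_neq dP); lia.
have [rw2|rw2] := leqP 2 (d r w).
  have [|v wv vr] := mm_geo dP (x := w) (y := r) (j := 1); first by lia.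
  have rv := mm_sym dP r v; have vw := mm_sym dP v w.
  apply: (step v) => //.
    have := mm_tri dP v w b; have := mm_tri dP r v b; have := rbG.2; lia.
  apply: (good_spread rbG wI) => //; first lia.
  by apply: (mm_neq dP); lia.
have rwb : d r w = d w b by lia.
have := cP rwb; rewrite eq_sym => /(_ wr wb) rb.
by have := good_neq rbG; rewrite rb eqxx.
Qed.

Lemma good_witness r b : good r b -> exists w,
  [/\ d r w + d w b = k, c w != c r & c w != c b].
Proof.
case=> /andP[_ /existsP[w /and3P[/eqP wI wr wb]]] rbk.
by exists w; rewrite wI.
Qed.

Lemma good_third r b z : good r b -> d r z + d z b = k -> z != r -> z != b ->
  c z != c r /\ c z != c b.
Proof.
move=> rbG zI nzr nzb; have [w [wI wr wb]] := good_witness rbG.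
by rewrite (good_interior rbG wI wr wb zI nzr nzb).
Qed.

Lemma good_gt0 r b : good r b -> 0 < k.
Proof.
move=> rbG; have := good_neq rbG; have [_ <-] := rbG => rb.
by rewrite (mm_sym dP); apply: (mm_gt0 dP); apply: contraNneq rb => ->.
Qed.

Lemma good_odd r b : good r b -> odd k.
Proof.
move=> rbG; apply: contraT => ek; have k0 := good_gt0 rbG; have rbk := rbG.2.
have [|m rm mb] := mm_geo dP (x := r) (y := b) (j := k./2); first by lia.
have rmb : d r m = d m b by lia.
have [|||mr mb'] := good_third rbG (z := m); first by lia.
- by rewrite eq_sym; apply: (mm_neq dP); lia.
- by apply: (mm_neq dP); lia.
have := cP rmb; rewrite eq_sym => /(_ mr mb') rb.
by have := good_neq rbG; rewrite rb eqxx.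
Qed.

Lemma good_gt2 r b : good r b -> 2 < k.
Proof.
move=> rbG; have := good_odd rbG.
have [w [wI wr wb]] := good_witness rbG.
have nwr : w != r by apply: contraNneq wr => ->.
have nwb : w != b by apply: contraNneq wb => ->.
have := mm_gt0 dP nwr; have := mm_gt0 dP nwb; have := mm_sym dP w r; lia.
Qed.

Lemma good_sphere r b x : good r b -> d r x = k -> c x != c r -> c x = c b.
Proof.
move=> rbG rx nxr; have rbk := rbG.2.
have brx : d b r = d r x by rewrite (mm_sym dP) rbk.
apply/esym; apply: (cP brx); last by rewrite eq_sym.
by rewrite eq_sym; apply: good_neq rbG.
Qed.

(** The vertex [m] has a third color and is equidistant from [b] and [x]. So [x] cannot be colored
    like [r], and [m] witnesses that the interval from [r] to [x] is tricolored too. *)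
Lemma good_sphere_median r b x m : good r b -> d r x = k -> m != r ->
  d r b = d r m + d m b -> d r x = d r m + d m x -> good r x /\ c x = c b.
Proof.
move=> rbG rx nmr rmb rmx; have rbk := rbG.2.
have [xb|nxb] := eqVneq x b; first by rewrite xb.
have nmb : m != b.
  apply: contraNneq nxb => mb; move: rmb rmx; rewrite mb (mm_refl dP) => _ bx.
  by apply/eqP; rewrite (mm_eq0 dP (x := b) (y := x)) //; lia.
have rmbk : d r m + d m b = k by lia.
have [mr mb] := good_third rbG rmbk nmr nmb.
have nxr : c x != c r.
  apply: contraNneq (mb) => xr; rewrite eq_sym; apply/eqP.
  have bmx : d b m = d m x by rewrite (mm_sym dP); lia.
  have := cP bmx; rewrite xr (eq_sym (c b)) mb mr => /(_ isT isT) br.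
  by have := good_neq rbG; rewrite br eqxx.
have xb := good_sphere rbG rx nxr; split=> //; split=> //.
apply: (tricoloredP (w := m)) => //; rewrite ?xb //.
exact: good_neq rbG.
Qed.

(** If [y] were nearer than [k], an interior vertex [z] of the interval at the same distance from
    [r] would give the rainbow progression [z, r, y]. *)
Lemma good_far_color r b w y : good r b -> d r w + d w b = k ->
  c w != c r -> c w != c b -> uniq [:: c r; c b; c w; c y] ->
  (forall x, d r x = k -> c x = c b) -> k < d r y.
Proof.
move=> rbG wI wr wb; rewrite /= !inE !negb_or.
move=> /and4P[/and3P[_ _ ry] /andP[_ yb] wy _] sph.
rewrite ltnNge; apply/negP => yk.
have [yk'|yk'] := eqVneq (d r y) k.
  by rewrite (sph _ yk') eqxx in yb.
have rbk := rbG.2.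
have [|z rz zb] := mm_geo dP (x := r) (y := b) (j := d r y); first by lia.
have nyr : y != r by apply: contraNneq ry => ->.
have := mm_gt0 dP nyr; have := mm_sym dP y r => yrS yr.
have zw : c z = c w.
  apply: (good_interior rbG wI wr wb); first by lia.
  - by rewrite eq_sym; apply: (mm_neq dP); lia.
  - by apply: (mm_neq dP); lia.
have zry : d z r = d r y by rewrite (mm_sym dP).
have := cP zry; rewrite zw wr ry => /(_ isT isT) /eqP.
by rewrite (negPf wy).
Qed.

Lemma good_sphere_neq r b x : good r b -> d r x = k -> c x = c r \/ c x = c b.
Proof.
move=> rbG rx; have [|] := eqVneq (c x) (c r); first by left.
by move=> xr; right; apply: (good_sphere rbG).
Qed.

(* Shows that r and b cannot lie in a common row: r1 is the vertex after r on
   that row, r' and b' lie in an adjacent row next to r1 and to the vertex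
   before b.  Then r' has the color of r, so (r', b) is again good, and b' would
   be interior to it although it lies on the sphere around r through b. *)
Lemma good_detour r b r1 r' b' : good r b -> d r r1 = 1 -> d r1 b = k.-1 ->
  d r1 r' = 1 -> d r' b = k -> d r b' = k -> d r' b' + d b' b = k ->
  b' != r' -> b' != b -> False.
Proof.
move=> rbG rr1 r1b r1r' r'b rb' b'I nb'r' nb'b.
have k2 := good_gt2 rbG; have rb := good_neq rbG.
have [||| r1r r1B] := good_third rbG (z := r1); first by lia.
- by rewrite eq_sym; apply: (mm_neq dP); lia.
- by apply: (mm_neq dP); lia.
have r'r : c r' = c r.
  have br' : d b r' = k by rewrite (mm_sym dP).
  have [r'B|//] := good_sphere_neq (good_sym rbG) br'.
  have rr1r' : d r r1 = d r1 r' by rewrite rr1.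
  have := cP rr1r'; rewrite eq_sym r1r r'B r1B => /(_ isT isT) rb0.
  by rewrite rb0 eqxx in rb.
have r'G : good r' b.
  split=> //; apply: (tricoloredP (w := r1)); rewrite ?r'r //.
  by rewrite (mm_sym dP r'); lia.
have [b'r' b'B] := good_third r'G b'I nb'r' nb'b.
have [b'r|b'b] := good_sphere_neq rbG rb'.
  by rewrite r'r b'r eqxx in b'r'.
by rewrite b'b eqxx in b'B.
Qed.

End Tricolored.

(** * Colorings of products *)

Section ProductColoring.
Variables (T T' : finType) (d : T -> T -> nat) (d' : T' -> T' -> nat).
Variables (C : eqType) (c : T * T' -> C).
Hypotheses (dP : median_metric d) (dP' : median_metric d').
Hypotheses (nbr : forall x, exists y, d x y = 1)
  (nbr' : forall x, exists y, d' x y = 1).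
Local Notation dd := (prod_dist d d').
Hypothesis cP : rainbow_free dd c.
Variable k : nat.
Hypothesis kmin : forall r b, tricolored dd c r b -> k <= dd r b.
Local Notation good := (good dd c k).

Let ddP : median_metric dd := prod_median_metric dP dP'.

Lemma good_neq2 r b : good r b -> r.2 != b.2.
Proof.
case: r b => s0 t [sk t1] rbG /=; apply/eqP => tt; subst t1.
have k2 := good_gt2 ddP cP kmin rbG.
have rbk := rbG.2; rewrite /prod_dist /= (mm_refl dP') addn0 in rbk.
have [t' tt'] := nbr' t.
have [|s1 s01 s1k] := mm_geo dP (x := s0) (y := sk) (j := 1); first by lia.
have [|s2 s12 s2k] := mm_geo dP (x := s1) (y := sk) (j := k.-2); first by lia.
have s02 := mm_tri dP s0 s2 sk; have s02' := mm_tri dP s0 s1 s2.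
have t't := mm_sym dP' t' t.
apply: (good_detour ddP cP kmin (r := (s0, t)) (b := (sk, t)) (r1 := (s1, t))
  (r' := (s1, t')) (b' := (s2, t'))) => //;
  try by rewrite /prod_dist /= ?(mm_refl dP) ?(mm_refl dP'); lia.
- by apply: (mm_neq ddP); rewrite /prod_dist /= (mm_sym dP) (mm_refl dP'); lia.
- by apply: (mm_neq ddP); rewrite /prod_dist /=; lia.
Qed.

Lemma good_neq1 r b : good r b -> r.1 != b.1.
Proof.
case: r b => t s0 [t1 sk] rbG /=; apply/eqP => tt; subst t1.
have k2 := good_gt2 ddP cP kmin rbG.
have rbk := rbG.2; rewrite /prod_dist /= (mm_refl dP) add0n in rbk.
have [t' tt'] := nbr t.
have [|s1 s01 s1k] := mm_geo dP' (x := s0) (y := sk) (j := 1); first by lia.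
have [|s2 s12 s2k] := mm_geo dP' (x := s1) (y := sk) (j := k.-2); first by lia.
have s02 := mm_tri dP' s0 s2 sk; have s02' := mm_tri dP' s0 s1 s2.
have t't := mm_sym dP t' t.
apply: (good_detour ddP cP kmin (r := (t, s0)) (b := (t, sk)) (r1 := (t, s1))
  (r' := (t', s1)) (b' := (t', s2))) => //;
  try by rewrite /prod_dist /= ?(mm_refl dP) ?(mm_refl dP'); lia.
- by apply: (mm_neq ddP); rewrite /prod_dist /= (mm_sym dP') (mm_refl dP); lia.
- by apply: (mm_neq ddP); rewrite /prod_dist /=; lia.
Qed.

(** [good_sphere_median] is used twice. In some coordinate [x] is at least as far from [r] as [b]
    is; [b] is first turned in that coordinate to a vertex [t] on the way to [x], and the result is
    then moved to [x]. The shared vertices differ from [r] because [r] and [b] differ in both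
    coordinates. *)
Lemma good_sphere_all r b x : good r b -> dd r x = k -> good r x /\ c x = c b.
Proof.
move=> rbG rx; have rbk := rbG.2.
have n1 := good_neq1 rbG; have n2 := good_neq2 rbG.
have median r' b' x' m := @good_sphere_median _ _ _ _ ddP cP _ kmin r' b' x' m.
case: r b x => r r' [b b'] [x x'] /= in rbG rx rbk n1 n2 *.
rewrite /prod_dist /= in rx rbk.
have n1' : 0 < d r b by apply: (mm_gt0 dP).
have n2' : 0 < d' r' b' by apply: (mm_gt0 dP').
have [le_b'|lt_b'] := leqP (d' r' b') (d' r' x').
  have [t rt tx] := mm_geo dP' le_b'.
  have [||||xG <-] := median (r, r') (b, b') (b, t) (b, r') rbG.
  - by rewrite /prod_dist /=; lia.
  - by apply: contra n1 => /eqP[->].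
  - by rewrite /prod_dist /= (mm_refl dP) (mm_refl dP'); lia.
  - by rewrite /prod_dist /= (mm_refl dP) (mm_refl dP'); lia.
  apply: (median _ _ _ (r, t) xG).
  - by rewrite /prod_dist /=; lia.
  - by rewrite eq_sym; apply: (mm_neq ddP); rewrite /prod_dist /= rt; lia.
  - by rewrite /prod_dist /= (mm_refl dP) (mm_refl dP'); lia.
  - by rewrite /prod_dist /= (mm_refl dP); lia.
have le_b : d r b <= d r x by lia.
have [t rt tx] := mm_geo dP le_b.
have [||||xG <-] := median (r, r') (b, b') (t, b') (r, b') rbG.
- by rewrite /prod_dist /=; lia.
- by apply: contra n2 => /eqP[->].
- by rewrite /prod_dist /= (mm_refl dP) (mm_refl dP'); lia.
- by rewrite /prod_dist /= (mm_refl dP) (mm_refl dP'); lia.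
apply: (median _ _ _ (t, r') xG).
- by rewrite /prod_dist /=; lia.
- by rewrite eq_sym; apply: (mm_neq ddP); rewrite /prod_dist /= rt; lia.
- by rewrite /prod_dist /= (mm_refl dP) (mm_refl dP'); lia.
- by rewrite /prod_dist /= (mm_refl dP'); lia.
Qed.

Lemma good_ecc1 r b s : good r b -> d r.1 s < k.
Proof.
move=> rbG; rewrite ltnNge; apply/negP => le_k.
have [z rz _] := mm_geo dP le_k.
have [|/good_neq2 /=] := good_sphere_all (x := (z, r.2)) rbG.
  by rewrite /prod_dist /= (mm_refl dP'); lia.
by rewrite eqxx.
Qed.

Lemma good_ecc2 r b s : good r b -> d' r.2 s < k.
Proof.
move=> rbG; rewrite ltnNge; apply/negP => le_k.
have [z rz _] := mm_geo dP' le_k.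
have [|/good_neq1 /=] := good_sphere_all (x := (r.1, z)) rbG.
  by rewrite /prod_dist /= (mm_refl dP); lia.
by rewrite eqxx.
Qed.

Lemma good_no_fourth_color r b w y : good r b -> dd r w + dd w b = k ->
  c w != c r -> c w != c b -> ~~ uniq [:: c r; c b; c w; c y].
Proof.
move=> rbG wI wr wb; apply/negP => un.
have far := good_far_color ddP cP kmin.
have ry := far _ _ _ _ rbG wI wr wb un (fun x rx => (good_sphere_all rbG rx).2).
have [z rz zy] := mm_geo ddP (ltnW ry).
have [zG zb] := good_sphere_all rbG rz.
have [v [vI vr vz]] := good_witness zG.
(* Were [v] colored like [y], it would be a vertex of a fourth color within distance [k] of [r]. *)
have nvy : c v != c y.
  apply/eqP => vy; have := un; rewrite -vy => un'.
  have := far _ _ _ _ rbG wI wr wb un' (fun x rx => (good_sphere_all rbG rx).2).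
  lia.
have zrG := good_sym ddP zG.
have vI' : dd z v + dd v r = k.
  by rewrite (mm_sym ddP z) (mm_sym ddP v r) addnC.
have un' : uniq [:: c z; c r; c v; c y].
  move: un; rewrite /= !inE !negb_or !andbT zb.
  move=> /andP[/and3P[rb _ ry'] /andP[/andP[_ bY] _]].
  rewrite (eq_sym (c b) (c r)) rb (eq_sym (c b) (c v)) -zb vz zb bY.
  by rewrite (eq_sym (c r)) vr ry' nvy.
have yz := far _ _ _ _ zrG vI' vz vr un'
  (fun x rx => (good_sphere_all zrG rx).2).
have := good_ecc1 y.1 rbG; have := good_ecc2 y.2 rbG.
move: yz zy rz; rewrite /prod_dist; lia.
Qed.

Variables D D' : nat.
Hypotheses (fp : four_point d) (leD : forall x y, d x y <= D)
  (leD' : forall x y, d' x y <= D').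
Hypothesis weak : near_triples d D.

(** With [t1] too far away, [z] can be taken one step beyond distance [k - D], and [(y, z)] lies on
    the sphere around [(s0, t0)], where [y] comes from [near_triples]. The vertex [(s, u)] is then
    on the sphere around [(y, z)], hence colored like [(s0, t0)], but interior to the interval up to
    [(s, v)]. *)
Lemma good_diametral_ecc s0 t0 s t t1 : 0 < D -> good (s0, t0) (s, t) ->
  d s0 s = D -> d' t0 t1 <= k - D.
Proof.
move=> D0 rbG s0s; rewrite leqNgt; apply/negP => lt_t1.
have k2 := good_gt2 ddP cP kmin rbG; have ok := good_odd ddP cP kmin rbG.
have ltD := good_ecc1 s rbG; rewrite /= s0s in ltD.
have [z t0z zt1] := mm_geo dP' lt_t1.
have [y [s0y ys]] := weak s0s.
have [|zG cz] := good_sphere_all (x := (y, z)) rbG.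
  by rewrite /prod_dist /=; lia.
have [|v t0v vz] := mm_geo dP' (x := t0) (y := z) (j := k - D); first by lia.
have [|vG cv] := good_sphere_all (x := (s, v)) rbG.
  by rewrite /prod_dist /=; lia.
have par := mm_parity dP s0 y s; have ysD := leD y s.
(* The distance is 0 or 1 and makes [(s, u)] and [(y, z)] exactly [k] apart. It is 1 only if
   [d y s = D]; then [D] is odd like [k], so [k - D] is at least 2 and [u] still differs from
   [v]. *)
have [|u t0u uv] := mm_geo dP' (x := t0) (y := v) (j := (d y s).+1 - D).
  by lia.
have uz := mm_tri dP' u v z; have uz' := mm_tri dP' t0 u z.
have [|_ cu] := good_sphere_all (x := (s, u)) (good_sym ddP zG).
  by rewrite /prod_dist /= (mm_sym dP' z); lia.
have [||| ur _] := good_third ddP cP kmin vG (z := (s, u)).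
- by rewrite /prod_dist /= (mm_refl dP); lia.
- by rewrite eq_sym; apply: (mm_neq ddP); rewrite /prod_dist /=; lia.
- by apply: (mm_neq ddP); rewrite /prod_dist /=; lia.
by rewrite cu eqxx in ur.
Qed.

Hypotheses (exD : exists x y, d x y = D) (fp' : four_point d')
  (exD' : exists x y, d' x y = D').

Lemma weak_no_good r b : ~~ odd (D + D') -> ~ good r b.
Proof.
move=> eDD rbG; have ok := good_odd ddP cP kmin rbG.
have D0 : 0 < D.
  by have [y xy] := nbr r.1; have := leD r.1 y; rewrite xy.
have [u [v uv]] := exD; have [u' [v' uv']] := exD'.
have far1 x : exists y, forall z, d x z <= d x y.
  by exists [arg max_(y > x) d x y]; case: arg_maxnP => // i _ h z; apply: h.
(* A vertex farthest from [r.1] ends a diametral path. Moving along spheres to [(s, t)] and then to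
   [(s2, t2)] gives a good pair whose first coordinates are at distance [D]. *)
have [s sfar] := far1 r.1.
have rbk := rbG.2; rewrite /prod_dist in rbk.
have [|t rt tb] := mm_geo dP' (x := r.2) (y := b.2) (j := k - d r.1 s).
  by have := sfar b.1; lia.
have lts := good_ecc1 s rbG.
have [|stG _] := good_sphere_all (x := (s, t)) rbG.
  by rewrite /prod_dist /=; lia.
have [s2 ss2] := farthest_peripheral fp leD uv sfar.
have ltD := good_ecc1 s2 (good_sym ddP stG); rewrite /= ss2 in ltD.
have [|t2 tt2 t2r] := mm_geo dP' (x := t) (y := r.2) (j := k - D).
  by rewrite (mm_sym dP') rt; have := leD r.1 s; lia.
have [|G _] := good_sphere_all (x := (s2, t2)) (good_sym ddP stG).
  by rewrite /prod_dist /=; lia.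
have far_t w : d' t w <= k - D := good_diametral_ecc w D0 G ss2.
have far_t2 := fun w => good_diametral_ecc w D0 (good_sym ddP G).
have ss2' : d s2 s = D by rewrite (mm_sym dP).
(* As [t2] is farthest from [t], its eccentricity is [D']. The bounds force [D' = k - D], so
   [D + D' = k] would be odd. *)
have [|w tw] := farthest_peripheral (x := t) (y := t2) fp' leD' uv'.
  by move=> z; rewrite tt2; apply: far_t.
have := far_t2 w ss2'; have := leD' t t2; lia.
Qed.

End ProductColoring.

(** * Bounds on the number of colors *)

Section ProductBounds.
Variables (T T' : finType) (d : T -> T -> nat) (d' : T' -> T' -> nat).
Variables (C : eqType) (c : T * T' -> C).
Hypotheses (dP : median_metric d) (dP' : median_metric d').
Hypotheses (nbr : forall x, exists y, d x y = 1)
  (nbr' : forall x, exists y, d' x y = 1).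
Hypothesis cP : rainbow_free (prod_dist d d') c.

Lemma no_four_colors s : uniq (map c s) -> size s = 4 -> False.
Proof.
have ddP := prod_median_metric dP dP'.
case: s => [|x1 [|x2 [|x3 [|x4 [|]]]]] // un _.
have un3 : uniq [:: c x1; c x2; c x3].
  by apply: (subseq_uniq (prefix_subseq _ [:: c x4])).
have [r [b rb]] := tricolored_exists ddP un3.
have [k [[r' [b' rbG]] kmin]] := min_tricolored rb.
have [w [wI wr wb]] := good_witness rbG.
pose s := map c [:: x1; x2; x3; x4].
have /allPn[y ys yn] : ~~ all (mem [:: c r'; c b'; c w]) s.
  by apply/negP => /allP sub; have := uniq_leq_size un sub.
have [z _ zy] := mapP ys.
have /negP[] := good_no_fourth_color dP dP' nbr nbr' cP kmin z rbG wI wr wb.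
have {}yn : y \notin [:: c r'; c b'; c w] by [].
rewrite -zy -[X in uniq X]/(rcons [:: c r'; c b'; c w] y) rcons_uniq yn.
by rewrite /= !inE negb_or !andbT (good_neq rbG) !(eq_sym _ (c w)) wr wb.
Qed.

Lemma weak_no_three_colors D D' x y z :
  four_point d -> (forall x y, d x y <= D) -> (exists x y, d x y = D) ->
  four_point d' -> (forall x y, d' x y <= D') -> (exists x y, d' x y = D') ->
  near_triples d D -> ~~ odd (D + D') -> ~~ uniq [:: c x; c y; c z].
Proof.
move=> fp leD exD fp' leD' exD' weak eDD; apply/negP => un.
have [r [b rb]] := tricolored_exists (prod_median_metric dP dP') un.
have [k [[r' [b' rbG]] kmin]] := min_tricolored rb.
exact: (weak_no_good dP dP' nbr nbr' cP kmin fp leD leD' weak exD fp' exD'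
  eDD rbG).
Qed.

End ProductBounds.

(** * A rainbow-free coloring for strongly non-3-peripheral trees *)

(* With D = diam T, the vertices x with d u x = D all lie at the end of the
   diameter where v is, and cannot be told apart from v by vertices at distance
   at least D.-1. *)
Record polar (T : Type) (d : T -> T -> nat) (D : nat) (u v : T) : Prop :=
  Polar {
  polar_dist : d u v = D;
  polar_near : forall x s, d u x = D -> D.-1 <= d v s \/ D.-1 <= d x s ->
    d x s = d v s;
  polar_far : forall x s, D.-1 <= d v s -> d s x = d v s -> d u x = D;
  polar_ecc : forall x s, d v s = D.-1 -> d s x <= D.-1
}.

Section Polar.
Variables (T : eqType) (d : T -> T -> nat) (D : nat).
Hypotheses (dP : median_metric d) (fp : four_point d).
Hypothesis leD : forall x y, d x y <= D.

Lemma polar_intro u v : 1 < D -> d u v = D ->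
  (forall x, d u x = D -> d v x + 2 <= D) ->
  (~~ odd D -> forall x y z, d x y = D -> d y z = D -> d x z <> D) ->
  (~~ odd D -> forall x y z, d x y = D -> d y z = D.-1 -> d x z <> D.-1) ->
  polar d D u v.
Proof.
move=> D1 uv K N0 N1; have S := mm_sym dP; split=> //.
- move=> x s ux big; have xv := K x ux; have vx := S v x.
  have us := leD u s; have su := S s u.
  have := fp u x v s; have := fp u v x s; have := S x s; have := S v s; lia.
- move=> x s big sx.
  have pv := mm_parity dP s v u; have px := mm_parity dP s v x.
  have pu := mm_parity dP v s x; have sv := S s v; have uv' := S v u.
  have us := S u s; have ux := S u x; have vx := S v x; have xs := S x s.
  (* If [d u x < D], the four-point condition gives [d u s + d v x >= D + d v s], so both terms are
     nearly [D]. Parity then leaves a vertex [s] contradicting [K] when [D] is odd, and a triple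
     excluded by [N0] or [N1] when [D] is even. *)
  have := fp u v s x; have := leD u x; have := leD v x; have := leD u s.
  have := leD v s => l1 l2 l3 l4 f.
  have [//|nux] := eqVneq (d u x) D.
  have [vsD|vsD] := eqVneq (d v s) D.
    have [oD|eD] := boolP (odd D); first by lia.
    have := N0 eD u v s uv vsD; lia.
  have [oD|eD] := boolP (odd D).
    have := K s; lia.
  have := N1 eD v x s; lia.
- move=> x s vs; have := fp u v s x; have := leD v x; have := leD u s.
  have := leD s x; have := leD u x.
  have := mm_parity dP v s x; have := K s; have := S u s; have := S s v; lia.
Qed.

End Polar.

Section PolarColoring.
Variables (T T' : finType) (d : T -> T -> nat) (d' : T' -> T' -> nat).
Hypotheses (dP : median_metric d) (dP' : median_metric d').
Variables (D D' : nat) (u v : T) (u' v' : T').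
Hypotheses (leD : forall x y, d x y <= D) (leD' : forall x y, d' x y <= D').
Hypotheses (uvP : polar d D u v) (uvP' : polar d' D' u' v').
Hypotheses (D1 : 1 < D) (D1' : 1 < D') (eDD : ~~ odd (D + D')).
Local Notation dd := (prod_dist d d').

Definition polar_coloring (x : T * T') : 'I_3 :=
  if (d u x.1 == D) && (d' u' x.2 == D') then inord 0
  else if dd (v, v') x == (D + D').-1 then inord 1 else inord 2.

Lemma polar_coloring_surj i : exists x, polar_coloring x = i.
Proof.
have uv := polar_dist uvP; have uv' := polar_dist uvP'.
have vu := mm_sym dP v u; have vu' := mm_sym dP' v' u'.
rewrite /polar_coloring /prod_dist.
case: i => [[|[|[|]]]] // lti; last 1 first.
- exists (v, u') => /=; rewrite uv (mm_refl dP) (mm_refl dP').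
  by rewrite !ifF; [apply/val_inj; rewrite /= inordK | lia..].
- exists (v, v') => /=; rewrite uv uv' !eqxx; apply/val_inj.
  by rewrite /= inordK.
have [|w vw wu] := mm_geo dP (x := v) (y := u) (j := D.-1); first by lia.
exists (w, u') => /=; rewrite ifF; last by rewrite (mm_refl dP'); lia.
by rewrite ifT; [apply/val_inj; rewrite /= inordK | lia].
Qed.

(** Vertices of colors 0 and 1 are at the odd distance [D + D' - 1], and the sphere of that radius
    around either one contains only the other color. In a rainbow progression, colors 0 and 1 in
    consecutive places would force the third vertex into one of them; at the two ends they would
    make the perimeter odd. *)
Lemma polar_coloring_rainbow_free : rainbow_free dd polar_coloring.
Proof.
have ddP := prod_median_metric dP dP'.
pose R x := (d u x.1 == D) && (d' u' x.2 == D').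
pose B x := dd (v, v') x == (D + D').-1.
have RB x b : R x -> B b -> dd x b = (D + D').-1.
  case: x b => x x' [b b'] /andP[/= /eqP ux /eqP ux'].
  rewrite /B /prod_dist /= => /eqP vb.
  have := leD v b; have := leD' v' b' => l l'.
  have n2 := @polar_near _ _ _ _ _ uvP x b ux.
  have n1 := @polar_near _ _ _ _ _ uvP' x' b' ux'.
  have := n1 ltac:(lia); have := n2 ltac:(lia); lia.
have sphereR x w : R x -> dd x w = (D + D').-1 -> B w.
  case: x w => x x' [b b'] /andP[/= /eqP ux /eqP ux'].
  rewrite /B /prod_dist /= => vb.
  have := leD x b; have := leD' x' b' => l l'; apply/eqP.
  have n2 := @polar_near _ _ _ _ _ uvP x b ux.
  have n1 := @polar_near _ _ _ _ _ uvP' x' b' ux'.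
  have := n1 ltac:(lia); have := n2 ltac:(lia); lia.
have sphereB x b : B b -> dd b x = (D + D').-1 -> R x.
  case: x b => x x' [b b']; rewrite /B /R /prod_dist /= => /eqP vb bx.
  have := leD b x; have := leD' b' x'; have := leD v b; have := leD' v' b'.
  move=> l1 l2 l3 l4.
  have f := @polar_far _ _ _ _ _ uvP x b.
  have f' := @polar_far _ _ _ _ _ uvP' x' b'.
  have e := polar_ecc uvP (s := b) x; have e' := polar_ecc uvP' (s := b') x'.
  (* One coordinate of [b] is at full distance from that of [v] or [v'], the other one short of it.
     [polar_ecc] keeps [x] from exchanging these roles, so the distances agree in each
     coordinate. *)
  have [bD|bD] := eqVneq (d v b) D.
    have l5 := e' ltac:(lia).
    by rewrite f ?f' ?eqxx //; lia.
  have l5 := e ltac:(lia).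
  by rewrite f ?f' ?eqxx //; lia.
have par x y z := mm_parity ddP x y z.
have S := mm_sym ddP.
have three x : [\/ R x /\ polar_coloring x = inord 0,
    B x /\ polar_coloring x = inord 1
    | polar_coloring x = inord 2 /\ ~~ R x /\ ~~ B x].
  rewrite /polar_coloring -/(R x) -/(B x).
  have [Rx|nRx] := boolP (R x); first by constructor 1.
  by have [Bx|nBx] := boolP (B x); [constructor 2|constructor 3].
move=> x y z xy.
have xy' := par x y z.
have [[Rx ->]|[Bx ->]|[-> [nRx nBx]]] := three x;
have [[Ry ->]|[By ->]|[-> [nRy nBy]]] := three y;
have [[Rz ->]|[Bz ->]|[-> [nRz nBz]]] := three z;
  rewrite ?eqxx // => _ _; exfalso.
- have := RB _ _ Rx By; move: xy => -> yz.
  by rewrite (sphereB _ _ By yz) in nRz.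
- have := RB _ _ Rx Bz; lia.
- have := RB _ _ Ry Bx; rewrite S xy => yz.
  by rewrite (sphereR _ _ Ry yz) in nBz.
- have := RB _ _ Rz Bx; rewrite S; lia.
- have := RB _ _ Ry Bz; rewrite -xy S => yz.
  by rewrite (sphereR _ _ Ry yz) in nBx.
- have := RB _ _ Rz By; rewrite S -xy S => yz.
  by rewrite (sphereB _ _ By yz) in nRx.
Qed.

End PolarColoring.

(** * Distances in graphs and trees *)

Section GraphDistance.
Variable G : sgraph.
Implicit Types x y z : G.

Lemma walk_of_lengthP x y n :
  reflect (exists p, [/\ path (@adj G) x p, last x p = y & size p = n])
          (walk_of_length x y n).
Proof.
apply: (iffP existsP) => [[p /andP[pP /eqP lP]]|[p [pP lP sP]]].
  by exists p; rewrite size_tuple.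
by exists (tcast sP (in_tuple p)); rewrite val_tcast pP lP eqxx.
Qed.

Lemma dist_walk x y : connect (@adj G) x y ->
  exists p, [/\ path (@adj G) x p, last x p = y & size p = dist x y].
Proof.
case/connectP=> p0 p0P ->; case: (shortenP p0P) => p pP up _.
apply/walk_of_lengthP; rewrite /dist.
have h : has (walk_of_length x (last x p)) (iota 0 #|G|).
  (* A repetition-free path has fewer than [#|G|] edges, so its length is among those searched by
     [dist]. *)
  apply/hasP; exists (size p); last by apply/walk_of_lengthP; exists p.
  rewrite mem_iota add0n /=.
  by have /card_uniqP := up; rewrite /= => <-; apply: max_card.
have := nth_find 0 h; rewrite nth_iota //.
by move: h; rewrite has_find size_iota.
Qed.

Lemma dist_le x p : path (@adj G) x p -> dist x (last x p) <= size p.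
Proof.
move=> pP; rewrite leqNgt; apply/negP => lt_d.
have lt_G : dist x (last x p) <= #|G|.
  by apply: leq_trans (find_size _ _) _; rewrite size_iota.
have := before_find 0 lt_d; rewrite nth_iota; last by lia.
by move/negbT/walk_of_lengthP; apply; exists p.
Qed.

(** Computes the distance in products and in trees with leaves added or deleted: walks raise [f x]
    by at most one per edge, and descending along [f x] produces a walk of length [f x y], which
    also gives connectedness. *)
Lemma dist_unique (f : G -> G -> nat) : (forall x, f x x = 0) ->
  (forall x y z, adj y z -> f x z <= (f x y).+1) ->
  (forall x y, x != y -> exists2 z, adj z y & f x y = (f x z).+1) ->
  forall x y, dist x y = f x y.
Proof.
move=> f0 fS fP x y.
have walk n : forall y, f x y = n -> exists p,
    [/\ path (@adj G) x p, last x p = y & size p = n].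
  elim: n => [|n IHn] {}y fy.
    have [<-|] := eqVneq x y; first by exists [::].
    by move/fP => [z _]; rewrite fy.
  have [xy|] := eqVneq x y; first by rewrite xy f0 in fy.
  move/fP => [z zy]; rewrite fy => -[/esym/IHn[p [pP lP sP]]].
  by exists (rcons p y); rewrite rcons_path last_rcons size_rcons pP lP zy sP.
have low p : path (@adj G) x p -> f x (last x p) <= size p.
  elim/last_ind: p => [|p z IHp] /=; first by rewrite f0.
  rewrite rcons_path last_rcons size_rcons => /andP[/IHp le /fS-/(_ x)]; lia.
have [p [pP lP sP]] := walk _ _ (erefl (f x y)).
apply/eqP; rewrite eqn_leq -{1}lP -sP dist_le //=.
have [|q [qP lQ <-]] := @dist_walk x y; first by apply/connectP; exists p.
by rewrite sP -lQ low.
Qed.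

Hypothesis conn : forall x y, connect (@adj G) x y.

Lemma dist_refl x : dist x x = 0.
Proof. by apply/eqP; rewrite -leqn0; apply: (@dist_le x [::]). Qed.

Lemma dist_eq0 x y : dist x y = 0 -> x = y.
Proof. by have [p [_ <- <-]] := dist_walk (conn x y) => /size0nil->. Qed.

Lemma dist_tri x y z : dist x z <= dist x y + dist y z.
Proof.
have [p [pP lP <-]] := dist_walk (conn x y).
have [q [qP lQ <-]] := dist_walk (conn y z).
by rewrite -size_cat -lQ -lP -last_cat dist_le // cat_path pP lP.
Qed.

Lemma dist_adj x y : adj x y -> dist x y <= 1.
Proof. by move=> xy; apply: (@dist_le x [:: y]); rewrite /= xy. Qed.

Lemma adj_dist x y : adj x y = (dist x y == 1).
Proof.
apply/idP/eqP => [xy|].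
  have := dist_adj xy; case d0 : (dist x y) => [|[|]] //.
  by have := adj_irr x; rewrite {2}(dist_eq0 d0) xy.
have [p [pP <- <-]] := dist_walk (conn x y).
by case: p pP => [|z [|]] //= /andP[].
Qed.

Lemma dist_sym_le x y : dist x y <= dist y x.
Proof.
have [p [pP <- <-]] := dist_walk (conn y x).
have := rev_path (@adj G) y p; rewrite (eq_path (e' := @adj G)); last first.
  by move=> a b /=; rewrite adj_sym.
rewrite pP => pR; have := dist_le pR; rewrite size_rev size_belast.
by case: (p) => [|a q] //=; rewrite rev_cons last_rcons.
Qed.

Lemma dist_sym x y : dist x y = dist y x.
Proof. by apply/eqP; rewrite eqn_leq !dist_sym_le. Qed.

Lemma dist_geo x y j : j <= dist x y ->
  exists2 z, dist x z = j & dist x z + dist z y = dist x y.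
Proof.
have [p [pP lP sP]] := dist_walk (conn x y); rewrite -sP => lej.
pose z := last x (take j p).
have : path (@adj G) x (take j p ++ drop j p) by rewrite cat_take_drop.
rewrite cat_path -/z => /andP[p1 p2].
have := dist_le p1; rewrite size_takel // -/z => d1.
have := dist_le p2; rewrite size_drop -last_cat cat_take_drop lP => d2.
by exists z; have := dist_tri x z y; lia.
Qed.

Lemma dist_path x p z : path (@adj G) x p -> size p = dist x (last x p) ->
  z \in x :: p -> dist x z + dist z (last x p) = size p.
Proof.
move=> pP sP; rewrite inE => /predU1P[->|zp].
  by rewrite dist_refl.
have [p1 [p2 p12]] : exists p1 p2, p = rcons p1 z ++ p2.
  by case/splitPr: zp => p1 p2; exists p1, p2; rewrite cat_rcons.
have := pP; rewrite p12 cat_path last_rcons => /andP[d1 d2].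
have := dist_le d1; have := dist_le d2.
have := dist_tri x z (last x p).
by rewrite -sP p12 last_cat !last_rcons size_cat size_rcons; lia.
Qed.

Lemma geodesic_uniq x p : path (@adj G) x p -> size p = dist x (last x p) ->
  uniq (x :: p).
Proof.
move=> pP sP; case: (shortenP pP) sP => q qP uq sub sP.
have := dist_le qP; rewrite -sP => le_s.
apply: (leq_size_uniq uq) => //= a; rewrite !inE => /predU1P[->|/sub->].
  by rewrite eqxx.
by rewrite orbT.
Qed.

Lemma dist_walk_uniq x y : exists p,
  [/\ path (@adj G) x p, last x p = y, size p = dist x y & uniq (x :: p)].
Proof.
have [p [pP lP sP]] := dist_walk (conn x y); exists p; split=> //.
by apply: geodesic_uniq; rewrite ?lP.
Qed.

Hypothesis acy : acyclic G.

(** Going out through [p] and back through [q] closes a cycle; a nonempty interior gives it more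
    than two vertices. *)
Lemma acyclic_theta x v p q :
  path (@adj G) x (rcons p v) -> path (@adj G) x (rcons q v) ->
  uniq (x :: rcons p v) -> uniq (x :: rcons q v) -> ~~ has (mem q) p ->
  0 < size p + size q -> False.
Proof.
move=> pP qP up uq npq s0; apply: (acy (p := x :: rcons p v ++ rev q)).
  by rewrite /= size_cat size_rcons size_rev; lia.
apply/andP; split.
  rewrite /= rcons_cat cat_path pP last_rcons -rev_cons -(belast_rcons x q v).
  rewrite -{1}(last_rcons x q v) rev_path.
  by rewrite (eq_path (e' := @adj G)) // => a b /=; rewrite adj_sym.
move: up uq; rewrite -cat_cons cat_uniq rev_uniq /= => -> /andP[xq].
rewrite rcons_uniq => /andP[vq ->]; rewrite andbT /= has_rev.
apply/hasPn => a aq; rewrite inE mem_rcons inE !negb_or; apply/and3P; split.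
- by apply: contraNneq xq => <-; rewrite mem_rcons inE aq orbT.
- by apply: contraNneq vq => <-.
- by apply: contra npq => ap; apply/hasP; exists a.
Qed.

(* If the paths leave x by different edges, then the first vertex v of p that
   lies on q closes a cycle. *)
Lemma uniq_path_eq x p q : path (@adj G) x p -> path (@adj G) x q ->
  uniq (x :: p) -> uniq (x :: q) -> last x p = last x q -> p = q.
Proof.
elim: p x q => [|a p IHp] x [|b q] //.
- by move=> _ _ _ /= /andP[xq _] xl; rewrite {1}xl mem_last in xq.
- by move=> _ _ /= /andP[xq _] _ xl; rewrite -{1}xl mem_last in xq.
have [<-|nab] := eqVneq a b.
  move=> /= /andP[_ pP] /andP[_ qP] /andP[_ up] /andP[_ uq] l.
  by rewrite (IHp a q).
move=> pP qP up uq l; exfalso.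
have hp : has (mem (b :: q)) (a :: p).
  apply/hasP; exists (last a p); first exact: mem_last.
  by rewrite -[last a p]/(last x (a :: p)) l; apply: (mem_last b q).
have [v [p1 [p2 [vq np1 pE]]]] : exists v p1 p2,
    [/\ v \in b :: q, ~~ has (mem (b :: q)) p1 & a :: p = rcons p1 v ++ p2].
  by case: (split_find hp) => v p1 p2 vq np1; exists v, p1, p2.
have [q1 [q2 qE]] : exists q1 q2, b :: q = rcons q1 v ++ q2.
  by case/splitPr: vq => q1 q2; exists q1, q2; rewrite cat_rcons.
move: pP qP up uq np1; rewrite pE qE !cat_path -!cat_cons !cat_uniq.
move=> /andP[pP _] /andP[qP _] /andP[up _] /andP[uq _] np1.
apply: (acyclic_theta pP qP up uq).
  apply: contra np1 => /hasP[z zp zq]; apply/hasP; exists z => //=.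
  by rewrite mem_cat mem_rcons inE (zq : z \in q1) orbT.
case: p1 q1 pE qE {pP qP up uq np1} => [|? ?] [|? ?] //= [av _] [bv _].
by rewrite av bv eqxx in nab.
Qed.

Lemma dist_uniq_path x p : path (@adj G) x p -> uniq (x :: p) ->
  dist x (last x p) = size p.
Proof.
move=> pP up; have [q [qP lQ <- uq]] := dist_walk_uniq x (last x p).
by rewrite (uniq_path_eq qP pP uq up lQ).
Qed.

(** The geodesics from [x] to [y] through [z] and through [w] are the same path, so [z] lies before
    or after [w] on it. *)
Lemma interval_linear x y z w : dist x z + dist z y = dist x y ->
  dist x w + dist w y = dist x y ->
  dist x z + dist z w = dist x w \/ dist w z + dist z y = dist w y.
Proof.
move=> zI wI.
have [p [pP lP sP]] := dist_walk (conn x w).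
have [q [qP lQ sQ]] := dist_walk (conn w y).
have [p' [pP' lP' sP']] := dist_walk (conn x z).
have [q' [qP' lQ' sQ']] := dist_walk (conn z y).
have pq : p ++ q = p' ++ q'.
  apply: (@uniq_path_eq x); rewrite ?cat_path ?pP ?pP' ?lP ?lP' //=;
    try apply: geodesic_uniq; rewrite ?cat_path ?pP ?pP' ?last_cat ?lP ?lP'
      ?size_cat ?lQ ?lQ' //; lia.
have : z \in x :: p ++ q by rewrite pq -lP' -cat_cons mem_cat mem_last.
rewrite -cat_cons mem_cat => /orP[zp|zq].
  by left; have := dist_path pP; rewrite lP -sP; apply.
by right; have := dist_path qP; rewrite lQ -sQ; apply; rewrite // inE zq orbT.
Qed.

(** By minimality the paths from [z] to [m] and from [m] to [x] meet only in [m], so their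
    concatenation is the unique path. *)
Lemma dist_closest x y z m : dist x m + dist m y = dist x y ->
  (forall a, dist x a + dist a y = dist x y -> dist z m <= dist z a) ->
  dist x m + dist m z = dist x z.
Proof.
move=> mI mmin.
have [p [pP lP sP up]] := dist_walk_uniq z m.
have [q [qP lQ sQ uq]] := dist_walk_uniq m x.
rewrite (dist_sym x z) (dist_sym x m) (dist_sym m z) -sP -sQ addnC -size_cat.
rewrite -lQ -lP -last_cat.
apply/esym/dist_uniq_path; first by rewrite cat_path pP lP.
rewrite -cat_cons cat_uniq up; move: (uq) => /= /andP[mq ->]; rewrite andbT /=.
apply/hasPn => a aq; apply/negP => ap.
have := dist_path pP; rewrite lP => /(_ a sP ap) za.
have := dist_path qP; rewrite lQ => /(_ a sQ); rewrite inE aq orbT.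
move=> /(_ isT) ma; have := mmin a.
have := dist_sym x m; have := dist_sym x a; have := dist_sym m a.
have := dist_tri a m y; have := dist_tri x a y => *.
have a0 : dist a m = 0 by lia.
by rewrite -(dist_eq0 a0) aq in mq.
Qed.

Lemma tree_median_metric : median_metric (@dist G).
Proof.
split; [exact: dist_refl|exact: dist_eq0|exact: dist_sym|exact: dist_tri| |].
  exact: dist_geo.
move=> x y z.
pose P a := dist x a + dist a y == dist x y.
have x0 : P x by rewrite /P dist_refl.
(* The median is the vertex of the interval between [x] and [y] closest to [z]. *)
case: (@arg_minnP _ x P (dist z) x0) => m /eqP mI mmin.
have mmin' a : dist x a + dist a y = dist x y -> dist z m <= dist z a.
  by move=> /eqP/mmin.
exists m; split; [by []|exact: dist_closest mI mmin'|].
have sym a : dist y a + dist a x = dist x a + dist a y.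
  by rewrite addnC (dist_sym x) (dist_sym y).
by apply: (@dist_closest y x) => [|a]; rewrite sym (dist_sym y x) // => /mmin'.
Qed.

(** The projections [m] and [m'] of [u] and [v] to the path from [x] to [y] occur in one of two
    orders, which decides the larger sum. *)
Lemma tree_four_point : four_point (@dist G).
Proof.
move=> x y u v.
have [m [mxy mxu myu]] := mm_med tree_median_metric x y u.
have [m' [mxy' mxv myv]] := mm_med tree_median_metric x y v.
have := dist_tri u m v; have := dist_tri m m' v.
have := dist_sym u m; have := dist_sym m m'; have := dist_sym m y.
have := dist_sym m' y; have := dist_sym m x; have := dist_sym m' x.
have [] := interval_linear mxy mxy'; lia.
Qed.

End GraphDistance.

Section Diameter.
Variable G : sgraph.
Implicit Types x y z : G.

Lemma dist_diam x y : dist x y <= diam G.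
Proof.
apply: leq_trans (leq_bigmax x); rewrite /ecc.
exact: (leq_bigmax (F := fun y => dist x y)).
Qed.

Lemma diam_attained : 0 < #|G| -> exists x y, dist x y = diam G.
Proof.
move=> G0; rewrite /diam; have [x ->] := eq_bigmax (@ecc G) G0.
by rewrite /ecc; have [y ->] := eq_bigmax (@dist G x) G0; exists x, y.
Qed.

Lemma diam_unique n : (forall x y, dist x y <= n) ->
  (exists x y, dist x y = n) -> diam G = n.
Proof.
move=> le_n [x [y xy]]; apply/eqP; rewrite eqn_leq -{2}xy dist_diam andbT.
by apply/bigmax_leqP => a _; apply/bigmax_leqP => b _.
Qed.

Lemma peripheralP x :
  0 < #|G| -> reflect (exists y, dist x y = diam G) (peripheral x).
Proof.
move=> G0; apply: (iffP eqP) => [<-|[y xy]].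
  by rewrite /ecc; have [y ->] := eq_bigmax (@dist G x) G0; exists y.
apply/eqP; rewrite eqn_leq /diam (leq_bigmax x) /= -/(diam G) -xy /ecc.
exact: (leq_bigmax (F := fun y => dist x y)).
Qed.

Lemma three_peripheralP :
  reflect (exists x y z, [/\ uniq [:: x; y; z], dist x y = diam G,
             dist y z = diam G & dist x z = diam G])
          (three_peripheral G).
Proof.
apply: (iffP existsP) => [[x /existsP[y /existsP[z]]]|[x [y [z [u xy yz xz]]]]].
  by move=> /and4P[u /eqP xy /eqP yz /eqP xz]; exists x, y, z.
exists x; apply/existsP; exists y; apply/existsP; exists z.
by rewrite u xy yz xz !eqxx.
Qed.

End Diameter.

Section GraphNeighbors.
Variable G : sgraph.
Hypothesis conn : forall x y, connect (@adj G) x y.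
Implicit Types x y z : G.

Lemma dist_pred x y : x != y -> exists2 z, adj z y &
  dist x y = (dist x z).+1 /\ dist x z + dist z y = dist x y.
Proof.
move=> nxy; have d0 : 0 < dist x y.
  by rewrite lt0n; apply: contra_neq nxy => /(dist_eq0 conn).
have [|z xz zy] := dist_geo conn (x := x) (y := y) (j := (dist x y).-1).
  by lia.
by exists z; [rewrite adj_dist //; lia | lia].
Qed.

Lemma dist_adjS x y z : adj y z -> dist x z <= (dist x y).+1.
Proof.
by move=> yz; have := dist_tri conn x y z; have := dist_adj yz; lia.
Qed.

Lemma exists_neq x : 1 < #|G| -> exists y, y != x.
Proof.
move=> G1; have [y yx|h] := pickP (predC1 x); first by exists y.
move: G1; rewrite (@eq_card1 _ x) // => y.
by have := h y; rewrite !inE => /negbFE.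
Qed.

End GraphNeighbors.

(** * Distance and diameter of Cartesian products *)

Section CartesianDistance.
Variables G H : sgraph.
Hypotheses (connG : forall x y, connect (@adj G) x y)
  (connH : forall x y, connect (@adj H) x y).

Lemma cart_dist (x y : G □ H) : dist x y = prod_dist (@dist G) (@dist H) x y.
Proof.
move: x y; apply: dist_unique => [[x x']|[x x'] [y y'] [z z']|[x x'] [y y']];
  rewrite /prod_dist /=.
- by rewrite !dist_refl.
- rewrite /adj /= /cart_adj /= => /orP[] /andP[/eqP <- /dist_adjS].
    by move=> /(_ connH x'); lia.
  by move=> /(_ connG x); lia.
have [<-|nxy _] := eqVneq x y.
  have [<-|nxy' _] := eqVneq x' y'; first by rewrite eqxx.
  have [z zy [e _]] := dist_pred connH nxy'.
  exists (x, z); first by rewrite /adj /= /cart_adj /= eqxx zy.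
  by rewrite /= e addnS.
have [z zy [e _]] := dist_pred connG nxy.
exists (z, y'); first by rewrite /adj /= /cart_adj /= eqxx zy orbT.
by rewrite /= e addSn.
Qed.

Lemma cart_diam : 0 < #|G| -> 0 < #|H| -> diam (G □ H) = diam G + diam H.
Proof.
move=> G0 H0; apply: diam_unique => [[x x'] [y y']|].
  rewrite cart_dist /prod_dist /=.
  by have := dist_diam x y; have := dist_diam x' y'; lia.
have [x [y xy]] := diam_attained G0; have [x' [y' xy']] := diam_attained H0.
by exists (x, x'), (y, y'); rewrite cart_dist /prod_dist /= xy xy'.
Qed.

End CartesianDistance.

(** * Peripherality of trees in terms of distances *)

Section TreePeripherality.
Variable T : sgraph.
Hypotheses (treeT : is_tree T) (nontrivT : 1 < #|T|).
Local Notation D := (diam T).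

Let conn : forall x y, connect (@adj T) x y := treeT.1.2.
Let T0 : 0 < #|T| := ltnW nontrivT.
Let mm : median_metric (@dist T) := tree_median_metric conn treeT.2.
Let fp : four_point (@dist T) := tree_four_point conn treeT.2.
Let leD := @dist_diam T.

Lemma neighbor x : exists y : T, dist x y = 1.
Proof.
have [y yx] := exists_neq x nontrivT; have := mm_gt0 mm yx.
rewrite (mm_sym mm) => /(mm_geo mm)[z xz _].
by exists z.
Qed.

Lemma diam_gt0 : 0 < D.
Proof.
have [x _] := card_gt0P T0; have [z xz] := neighbor x.
by rewrite -xz leD.
Qed.

Lemma add_leaf_dist u (x y : add_leaf u) : dist x y =
  match x, y with
  | Some a, Some b => @dist T a b
  | Some a, None | None, Some a => (dist a u).+1
  | None, None => 0
  end.
Proof.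
have S := mm_sym mm.
move: x y; apply: dist_unique => [[x|]|[x|] [y|] [z|]|[x|] [y|]] //=;
  rewrite ?dist_refl //.
- exact: dist_adjS.
- by move=> /eqP ->.
- by move=> /eqP ->; lia.
- by move=> /dist_adjS => /(_ conn u); rewrite !(S u); lia.
- by move=> /eqP ->; rewrite dist_refl.
- move=> nxy; have {}nxy : x != y by apply: contraNneq nxy => ->.
  have [z zy [e _]] := dist_pred conn nxy; by exists (Some z).
- by move=> _; exists (Some u); rewrite /adj /= ?eqxx.
- move=> _; have [<-|nuy] := eqVneq u y.
    by exists None; rewrite /adj /= ?eqxx ?dist_refl.
  have [z zy [e _]] := dist_pred conn nuy; exists (Some z) => //.
  by rewrite (S y) (S z) e.
Qed.

Lemma del_far_neq v (x : del_far v) : @dist T v (val x) != D.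
Proof. exact: (@valP T (del_far_pred v) {u : T | del_far_pred v u} x). Qed.

Lemma del_far_dist v (x y : del_far v) : dist x y = @dist T (val x) (val y).
Proof.
move: x y; apply: dist_unique => [x|x y z|x y nxy].
- by rewrite dist_refl.
- by rewrite /adj /= /del_far_adj; apply: dist_adjS.
have [z zy [e zI]] := dist_pred conn (nxy : val x != val y).
(* By the four-point condition the ball of radius [D.-1] around [v] is convex, so [z] is not
   deleted. *)
have Pz : del_far_pred v z.
  have vx := del_far_neq x; have vy := del_far_neq y; rewrite /del_far_pred.
  have := fp v z (val x) (val y); have := leD v (val x); have := leD v (val y).
  have := mm_sym mm z (val x).
  lia.
by exists (Sub z Pz); rewrite //= SubK.
Qed.

Lemma del_far_diam (v u : T) : dist v u = D -> diam (del_far v) = D.-1.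
Proof.
move=> vu; have D0 := diam_gt0; apply: diam_unique => [x y|].
  have vx := del_far_neq x; have vy := del_far_neq y; rewrite del_far_dist.
  have := fp (val x) (val y) v u; have := leD v (val x); have := leD v (val y).
  have := leD (val x) u; have := leD (val y) u.
  have := mm_sym mm v (val x); have := mm_sym mm v (val y); lia.
have [|w vw wu] := mm_geo mm (x := v) (y := u) (j := D.-1); first by lia.
have Pv : del_far_pred v v by rewrite /del_far_pred dist_refl //; lia.
have Pw : del_far_pred v w by rewrite /del_far_pred vw; lia.
by exists (Sub v Pv), (Sub w Pw); rewrite del_far_dist.
Qed.

Lemma three_peripheralPn (x y z : T) : ~~ three_peripheral T ->
  dist x y = D -> dist y z = D -> dist x z <> D.
Proof.
move=> n3 xy yz xz; case/negP: n3; apply/three_peripheralP; exists x, y, z.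
have D0 := diam_gt0; split=> //=; rewrite !inE negb_or andbT -andbA.
by apply/and3P; split; apply: (mm_neq mm); lia.
Qed.

Lemma weak_ecc (p q w x : T) :
  dist p q = D -> dist q w = D.-1 -> dist p w = D.-1 -> dist w x < D.
Proof.
move=> pq qw pw; have D0 := diam_gt0.
have := fp w x p q; have := mm_sym mm w p; have := mm_sym mm w q.
have := leD x q; have := leD x p; have := leD w x; lia.
Qed.

(** By [weak_ecc] the new leaf does not increase the diameter, and it is at distance [D] from both
    [p] and [q]. *)
Lemma add_leaf_three_peripheral (p q w : T) : dist p q = D -> dist q w = D.-1 ->
  dist p w = D.-1 -> three_peripheral (add_leaf w).
Proof.
move=> pq qw pw; have D0 := diam_gt0.
have ew x : dist w x < D := weak_ecc x pq qw pw.
have dE : diam (add_leaf w) = D.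
  apply: diam_unique => [[x|] [y|]|]; rewrite ?add_leaf_dist //.
  - by rewrite (mm_sym mm).
  - by rewrite (mm_sym mm).
  by exists (Some p), (Some q); rewrite add_leaf_dist.
apply/three_peripheralP; exists (Some p), (Some q), None.
rewrite !add_leaf_dist dE; split=> //=; try lia.
rewrite !inE !andbT orbF; apply: (contra_neq (z1 := p) (z2 := q)).
  by case=> ->.
by apply: (mm_neq mm); lia.
Qed.

Lemma strong_polar : strongly_non_three_peripheral T -> 1 < D ->
  exists u v, polar (@dist T) D u v.
Proof.
case/andP=> n3; have D0 := diam_gt0; case: ifPn => oD.
  move=> /existsP[v /andP[/(peripheralP _ T0)[u vu] nf]] D1.
  have uv : dist u v = D by rewrite (mm_sym mm).
  exists u, v; apply: (polar_intro mm fp leD) => //; try by rewrite oD.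
  move=> x ux; rewrite leqNgt; apply: contra nf => big.
  (* If [K] failed at [x], parity would put [v], [x] and the vertex [w] just before [u] pairwise at
     distance [D.-1], the diameter of [del_far v]. *)
  have [|w vw wu] := mm_geo mm (x := v) (y := u) (j := D.-1); first by lia.
  have := mm_parity mm v u x; have := mm_parity mm v w x.
  have := mm_tri mm w u x; have := mm_tri mm u w x; have := mm_sym mm w u.
  have wx := leD w x; have vx := leD v x => ? ? ? p1 p2.
  have Pv : del_far_pred v v by rewrite /del_far_pred dist_refl //; lia.
  have Pw : del_far_pred v w by rewrite /del_far_pred vw; lia.
  have Px : del_far_pred v x by rewrite /del_far_pred; lia.
  apply/three_peripheralP; exists (Sub v Pv), (Sub w Pw), (Sub x Px).
  rewrite !del_far_dist !SubK (del_far_diam vu); split; try lia.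
  rewrite /= !inE negb_or andbT -andbA -!val_eqE /=.
  by apply/and3P; split; apply: (mm_neq mm); lia.
move=> /forallP nl D1; have [u [v uv]] := diam_attained T0; exists u, v.
apply: (polar_intro mm fp leD) => //.
(* For [d v x], parity excludes [D.-1] and the lack of a peripheral triple excludes [D]. *)
- move=> x ux; have := three_peripheralPn (x := x) (y := u) (z := v) n3.
  have := mm_parity mm u x v; have := mm_sym mm x u; have := mm_sym mm x v.
  have := leD v x; lia.
- by move=> _ x y z; apply: three_peripheralPn.
- move=> _ x y z xy yz xz; have /negP := nl z; apply.
  exact: (add_leaf_three_peripheral xy).
Qed.

Lemma weak_near_triples :
  weakly_non_three_peripheral T -> near_triples (@dist T) D.
Proof.
case/andP=> n3; have D0 := diam_gt0; case: ifPn => oD.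
  move=> /forallP wk x y xy.
  have /implyP/(_ _)/three_peripheralP := wk x; case.
    by apply/(peripheralP _ T0); exists y.
  rewrite (del_far_diam xy) => a [b [c]].
  rewrite !del_far_dist => -[_ ab bc ac].
  move: a b c ab bc ac => [a Pa] [b Pb] [c Pc] /=.
  rewrite /del_far_pred in Pa Pb Pc => ab bc ac.
  have pair p q : dist p q = D.-1 -> dist x p != D -> dist x q != D ->
    dist x p = D.-1 /\ dist q y = D \/ dist x q = D.-1 /\ dist p y = D.
    move=> pq xp xq; have := fp p q x y.
    have := mm_sym mm p x; have := mm_sym mm q x.
    have := leD x p; have := leD x q; have := leD p y; have := leD q y; lia.
  (* Each pair has one member at distance D.-1 from x and the other at distance
     D from y, so one of the three vertices has both properties. *)
  have [] := pair _ _ ab Pa Pb; have [] := pair _ _ bc Pb Pc;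
    have [] := pair _ _ ac Pa Pc; move=> [? ?] [? ?] [? ?];
    by [exists a; lia | exists b; lia | exists c; lia].
move=> /existsP[w /three_peripheralP] wk x y xy.
have [p [q [pq qw pw]]] : exists p q : T,
    [/\ dist p q = D, dist q w = D.-1 & dist p w = D.-1].
  have [u [v uv]] := diam_attained T0.
  have le_d : D <= diam (add_leaf w).
    have := dist_diam (Some u : add_leaf w) (Some v).
    by rewrite add_leaf_dist uv.
  move: wk => [[a|] [[b|] [[c|] []]]]; rewrite !add_leaf_dist => //= _ ab bc ac.
  - exfalso; apply: (three_peripheralPn (x := a) (y := b) (z := c) n3).
    + by have := leD a b; lia.
    + by have := leD b c; lia.
    by have := leD a c; have := leD a b; lia.
  - by exists a, b; have := leD a b; split; lia.
  - by exists a, c; have := leD a c; split; lia.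
  - by exists b, c; have := leD b c; split; lia.
have ew z : dist w z < D := weak_ecc z pq qw pw.
(* Both inequalities are tight, each with two alternatives. By [n1] and [n2] they cannot choose the
   same one, so [w] is at distance [D.-1] from both [x] and [y]. *)
have f1 := fp x y p w; have f2 := fp x y q w.
have n1 := three_peripheralPn (x := p) (y := x) (z := q) n3.
have n2 := three_peripheralPn (x := p) (y := y) (z := q) n3.
exists w; have := ew x; have := ew y.
have := mm_sym mm w y; have := mm_sym mm w x; have := mm_sym mm x p.
have := mm_sym mm y q; have := mm_sym mm y p; have := mm_sym mm x q.
have := leD x p; have := leD x q; have := leD y p; have := leD y q; lia.
Qed.

End TreePeripherality.

(** * Trees of diameter one *)

Section PathTwo.
Variable T : sgraph.
Hypotheses (treeT : is_tree T) (nontrivT : 1 < #|T|).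
Let mm : median_metric (@dist T) := tree_median_metric treeT.1.2 treeT.2.

Lemma diam_gt1 : ~ giso T (path_graph 2) -> 1 < diam T.
Proof.
have D0 := diam_gt0 treeT nontrivT; move=> nP2; rewrite ltn_neqAle D0 andbT.
apply/eqP => D1; apply: nP2.
have [x [y]] := diam_attained (ltnW nontrivT); rewrite -D1 => xy.
(* A third vertex would form a triangle of odd perimeter 3. *)
have two z : z != x -> z = y.
  move=> zx; apply/eqP; apply: contraT => zy.
  have := mm_gt0 mm zx; have := mm_gt0 mm zy.
  have := dist_diam z x; have := dist_diam z y; have := mm_parity mm z x y; lia.
have nyx : y != x by rewrite eq_sym; apply: (mm_neq mm); lia.
pose f (z : T) : path_graph 2 := inord (z != x).
have fE (z : T) : val (f z) = (z != x) by rewrite /= inordK //; case: (z != x).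
exists f; split; last first.
  move=> a b; rewrite {1}/adj /= /path_adj !fE (adj_dist treeT.1.2).
  have [->|/two ->] := eqVneq a x; have [->|/two ->] := eqVneq b x;
    by rewrite ?eqxx ?(negPf nyx) /= ?(mm_refl mm) ?(mm_sym mm y x) ?xy.
exists (fun i : path_graph 2 => if val i == 0 then x else y).
  by move=> z; rewrite fE; have [->|/two ->] := eqVneq z x.
move=> i; apply: val_inj; rewrite fE.
by case: i => [[|[|]]] // ?; rewrite /= ?eqxx ?nyx.
Qed.

Lemma path2_near_triples :
  giso T (path_graph 2) -> near_triples (@dist T) (diam T).
Proof.
move=> [f [bij_f _]] x y xy.
have cT : #|T| = 2 by rewrite (bij_eq_card bij_f) card_ord.
(* For diameter at most 1 the required distance [(diam T).-1] is 0, so [x] itself serves. *)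
suff : diam T <= 1 by exists x; rewrite (mm_refl mm); lia.
rewrite -xy leqNgt; apply/negP => xy2.
have [|z xz zy] := mm_geo mm (x := x) (y := y) (j := 1); first by lia.
have /card_uniqP : uniq [:: x; z; y].
  rewrite /= !inE negb_or andbT -andbA.
  by apply/and3P; split; apply: (mm_neq mm); lia.
by move=> c3; have := max_card (mem [:: x; z; y]); rewrite c3 cT.
Qed.

End PathTwo.

(** * The anti-van der Waerden number *)

Section AntiVanDerWaerden.
Variable G : sgraph.

Lemma rainbow_APP r (c : {ffun G -> 'I_r}) :
  reflect (rainbow_free (@dist G) c) (~~ has_rainbow_AP 3 c).
Proof.
apply: (iffP idP) => [nAP x y z xyz cxy cyz|rf].
  apply/eqP; apply: contraNT nAP => cxz.
  apply/existsP; exists [tuple x; y; z].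
  have lt_d : dist x y < #|G|.+1.
    by rewrite ltnS; apply: leq_trans (find_size _ _) _; rewrite size_iota.
  apply/existsP; exists (Ordinal lt_d).
  by rewrite /is_AP /= eqxx xyz eqxx !inE negb_or cxy cxz cyz.
apply/existsP => -[[[|x [|y [|z [|]]]] // sz] /existsP[n]].
rewrite /is_AP /= !inE negb_or !andbT.
move=> /andP[/andP[/eqP xy /eqP yz] /andP[/andP[cxy cxz] cyz]].
by rewrite (rf x y z) ?eqxx ?xy ?yz in cxz.
Qed.

Lemma aw_eq k n : forces_rainbow G k n ->
  (forall m, m < n -> ~~ forces_rainbow G k m) -> aw G k = n.
Proof.
move=> fn low; rewrite /aw; case: ex_minnP => m fm min_m; apply/eqP.
rewrite eqn_leq min_m // leqNgt; apply/negP => /low.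
by rewrite fm.
Qed.

Lemma not_forces_lt3 r : 1 < #|G| -> r < 3 -> ~~ forces_rainbow G 3 r.
Proof.
move=> G1; case: r => [//|r] r3; rewrite /forces_rainbow /=.
have [x _] := card_gt0P (ltnW G1).
have [y yx] := exists_neq x G1.
(* With a single color [ord_max] equals [ord0], so [c] is exact for one color as well as for two. *)
pose c := [ffun z : G => if z == x then ord0 else @ord_max r].
rewrite negb_forall; apply/existsP; exists c.
rewrite negb_imply; apply/andP; split.
  apply/forallP => i; apply/existsP; have [->|i0] := eqVneq i ord0.
    by exists x; rewrite ffunE eqxx.
  exists y; rewrite ffunE (negPf yx); apply/eqP/val_inj => /=.
  by have := ltn_ord i; have : (i : nat) != 0 by []; lia.
apply/existsP => -[v /existsP[d /andP[_ /card_uniqP]]].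
rewrite size_map size_tuple => c3.
by have := max_card (mem (map c v)); rewrite c3 card_ord; lia.
Qed.

Lemma forces_rainbowP r : 0 < r -> forces_rainbow G 3 r <->
  forall c : {ffun G -> 'I_r}, (forall i, exists x, c x = i) ->
    ~ rainbow_free (@dist G) c.
Proof.
move=> r0; rewrite /forces_rainbow r0 /=; split.
  move=> /forallP h c sc /rainbow_APP/negP[]; apply: (implyP (h c)).
  by apply/forallP => i; have [x <-] := sc i; apply/existsP; exists x.
move=> h; apply/forallP => c; apply/implyP => /forallP sc.
apply: contraT => /rainbow_APP rf; case: (h c) => [i|//].
by have /existsP[x /eqP] := sc i; exists x.
Qed.

End AntiVanDerWaerden.

Theorem theorem1p3 (T T' : sgraph)
  (treeT : is_tree T) (treeT' : is_tree T')
  (nontrivT : 1 < #|T|) (nontrivT' : 1 < #|T'|)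
  (even_diam : ~~ odd (diam (T □ T'))) :
  ((weakly_non_three_peripheral T \/ giso T (path_graph 2) \/
    weakly_non_three_peripheral T' \/ giso T' (path_graph 2)) ->
   aw (T □ T') 3 = 3) /\
  ((strongly_non_three_peripheral T /\ strongly_non_three_peripheral T' /\
    ~ giso T (path_graph 2) /\ ~ giso T' (path_graph 2)) ->
   aw (T □ T') 3 = 4).
Proof.
have [conn conn'] := (treeT.1.2, treeT'.1.2).
have T0 := ltnW nontrivT; have T0' := ltnW nontrivT'.
have mm := tree_median_metric conn treeT.2.
have mm' := tree_median_metric conn' treeT'.2.
have fp := tree_four_point conn treeT.2.
have fp' := tree_four_point conn' treeT'.2.
have nbr := neighbor treeT nontrivT; have nbr' := neighbor treeT' nontrivT'.
have dE := cart_dist conn conn'.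
rewrite cart_diam // in even_diam.
have TT1 : 1 < #|T □ T'|.
  by rewrite /= card_prod; move: nontrivT nontrivT'; nia.
have rfE (C : eqType) (c : T * T' -> C) : rainbow_free (@dist (T □ T')) c <->
    rainbow_free (prod_dist (@dist T) (@dist T')) c.
  by split=> rf x y z; have := rf x y z; rewrite !dE.
split.
  move=> wk; apply: aw_eq => [|m]; last exact: not_forces_lt3.
  apply/forces_rainbowP => // c sc /rfE rf.
  have [x cx] := sc (inord 0); have [y cy] := sc (inord 1).
  have [z cz] := sc (inord 2).
  have un : uniq [:: c x; c y; c z].
    by rewrite cx cy cz /= !inE -!val_eqE /= !inordK.
  have [wkT|wkT'] : near_triples (@dist T) (diam T) \/
      near_triples (@dist T') (diam T').
  - move: wk => [|[|[|]]].
    + by left; apply: weak_near_triples.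
    + by left; apply: path2_near_triples.
    + by right; apply: weak_near_triples.
    by right; apply: path2_near_triples.
  - have := weak_no_three_colors mm mm' nbr nbr' rf x y z fp
      (@dist_diam T) (diam_attained T0) fp' (@dist_diam T') (diam_attained T0')
      wkT even_diam.
    by rewrite un.
  (* The bound asks for [near_triples] in the first factor, so the factors are exchanged. *)
  pose sw (u : T' * T) := (u.2, u.1).
  have rf' : rainbow_free (prod_dist (@dist T') (@dist T)) (c \o sw).
    move=> a b e; rewrite /prod_dist addnC [RHS]addnC.
    exact: (rf (sw a) (sw b) (sw e)).
  have swK u : (c \o sw) (u.2, u.1) = c u by case: u.
  rewrite addnC in even_diam.
  have := weak_no_three_colors mm' mm nbr' nbr rf'
      (x.2, x.1) (y.2, y.1) (z.2, z.1) fp' (@dist_diam T') (diam_attained T0')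
      fp (@dist_diam T) (diam_attained T0) wkT' even_diam.
  by rewrite !swK un.
move=> [st [st' [nP nP']]].
have D1 := diam_gt1 treeT nontrivT nP.
have D1' := diam_gt1 treeT' nontrivT' nP'.
apply: aw_eq => [|m].
  apply/forces_rainbowP => // c sc /rfE rf.
  have [x cx] := sc (inord 0); have [y cy] := sc (inord 1).
  have [z cz] := sc (inord 2); have [w cw] := sc (inord 3).
  apply: (no_four_colors mm mm' nbr nbr' rf (s := [:: x; y; z; w])) => //.
  by rewrite /= cx cy cz cw /= !inE -!val_eqE /= !inordK.
rewrite ltnS leq_eqVlt => /predU1P[->|]; last exact: not_forces_lt3.
have [u [v uvP]] := strong_polar treeT nontrivT st D1.
have [u' [v' uvP']] := strong_polar treeT' nontrivT' st' D1'.
apply/negP => /forces_rainbowP.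
pose c := polar_coloring (@dist T) (@dist T') (diam T) (diam T') u v u' v'.
move=> /(_ isT (finfun c)); apply.
  move=> i.
  have [x <-] := polar_coloring_surj mm mm' uvP uvP' D1 D1' even_diam i.
  by exists x; rewrite ffunE.
apply/rfE => x y z; rewrite !ffunE.
exact: (polar_coloring_rainbow_free mm mm' (@dist_diam T) (@dist_diam T')
  uvP uvP' D1 D1' even_diam).
Qed.
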